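(* Let $\beta>0$, and suppose that in the Primal Splitting ADMM (described in the context) the $x_i$-subproblems are either solved exactly, or solved inexactly using the proximal gradient step (given in the context) with $\tau_i>\beta\,\rho(A_i^TA_i)$. Let $(\mathbf{x}^k,\mathbf{y}^k,\boldsymbol{\lambda}^k)$ be any sequence generated by the algorithm. Then, starting with any initial point $(\mathbf{x}^0,\mathbf{y}^0,\boldsymbol{\lambda}^0)\in\mathcal{X}\times\mathcal{Y}\times\Lambda$, the following hold. 1. The sequence $\{\boldsymbol{\lambda}^k\}$ converges to some $\boldsymbol{\lambda}^*$ which is a dual optimal solution of the split problem (P). 2. The sequence $\{\sum_{i=1}^m f_i(x_i^k)\}$ converges to $p^*$, the primal optimal value of (P). 3. For each $i=1,\dots,m$, the residual sequence $\{A_ix_i^k-y_i^k-\frac{b}{m}\}$ converges to $0$. 4. If the subproblem for $x_i$ is solved exactly for each $i$, then the sequences $\{A_ix_i^k\}$ and $\{y_i^k\}$ converge; if moreover $A_i$ has full column rank, then $\{x_i^k\}$ converges. If the subproblems for $x_i$ are solved inexactly using the proximal gradient step with $\tau_i>\beta\,\rho(A_i^TA_i)$, then the sequence $\{(\mathbf{x}^k,\mathbf{y}^k)\}$ converges to an optimal solution of (P).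
   Context: Original problem: minimize $\sum_{i=1}^m f_i(x_i)$ subject to $\sum_{i=1}^m A_ix_i=b$, $x_i\in\mathcal{X}_i$ ($i=1,\dots,m$), where $m\ge 2$, each $f_i:\mathbb{R}^{n_i}\to\mathbb{R}$ is a proper closed convex function (not necessarily smooth), $\mathcal{X}_i\subseteq\mathbb{R}^{n_i}$ is a closed convex set, $A_i\in\mathbb{R}^{\ell\times n_i}$ and $b\in\mathbb{R}^\ell$. It is assumed that its Lagrangian $\sum_i f_i(x_i)-\langle\lambda,\sum_iA_ix_i-b\rangle$ has a saddle point over $(x_1,\dots,x_m)\in\prod_i\mathcal{X}_i$ and $\lambda\in\mathbb{R}^\ell$. Split problem (P): minimize $\sum_{i=1}^m f_i(x_i)$ over $\mathbf{x}=(x_1,\dots,x_m)$ and $\mathbf{y}=(y_1,\dots,y_m)$ subject to $A_ix_i-\frac{b}{m}=y_i$, $x_i\in\mathcal{X}_i$ for $i=1,\dots,m$, and $\sum_{i=1}^m y_i=0$, $y_i\in\mathbb{R}^\ell$. Notation: $\mathcal{X}=\mathcal{X}_1\times\cdots\times\mathcal{X}_m$; $\mathcal{Y}=\{\mathbf{y}\in(\mathbb{R}^\ell)^m:\sum_{i=1}^m y_i=0\}$; $\Lambda=(\mathbb{R}^\ell)^m$; $\boldsymbol{\lambda}=(\lambda_1,\dots,\lambda_m)$ with $\lambda_i\in\mathbb{R}^\ell$ the multiplier of the constraint $A_ix_i-\frac{b}{m}=y_i$. A dual optimal solution of (P) is a maximizer over $\boldsymbol{\lambda}\in\Lambda$ of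 $\inf_{\mathbf{x}\in\mathcal{X},\,\mathbf{y}\in\mathcal{Y}}\ \sum_{i=1}^m f_i(x_i)-\sum_{i=1}^m\langle\lambda_i,A_ix_i-\frac{b}{m}-y_i\rangle$. $\rho(\cdot)$ denotes the spectral radius and $\|\cdot\|$ the Euclidean norm. Primal Splitting ADMM (penalty parameter $\beta>0$): for $k=0,1,2,\dots$, (a) $\mathbf{y}^{k+1}=\arg\min_{\mathbf{y}\in\mathcal{Y}}\frac{\beta}{2}\sum_{i=1}^m\|A_ix_i^k-\frac{b}{m}-y_i-\frac{\lambda_i^k}{\beta}\|^2$; (b) for each $i$, the $x_i$-subproblem, exact version: $x_i^{k+1}\in\arg\min_{x_i\in\mathcal{X}_i} f_i(x_i)+\frac{\beta}{2}\|A_ix_i-\frac{b}{m}-y_i^{k+1}-\frac{\lambda_i^k}{\beta}\|^2$; inexact version (proximal gradient step with parameter $\tau_i$): $x_i^{k+1}=\arg\min_{x_i\in\mathcal{X}_i} f_i(x_i)+\langle\beta A_i^T(A_ix_i^k-\frac{b}{m}-y_i^{k+1}-\frac{\lambda_i^k}{\beta}),\,x_i-x_i^k\rangle+\frac{\tau_i}{2}\|x_i-x_i^k\|^2$; (c) for each $i$, $\lambda_i^{k+1}=\lambda_i^k-\beta(A_ix_i^{k+1}-\frac{b}{m}-y_i^{k+1})$. *)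

(* Defs.v *)
From HB Require Import structures.
From mathcomp Require Import all_boot all_order all_algebra.
From mathcomp Require Import all_classical all_reals all_analysis.
From mathcomp Require Import complex.

Set Implicit Arguments.
Unset Strict Implicit.
Unset Printing Implicit Defensive.

Import Order.TTheory GRing.Theory Num.Theory.
Import numFieldNormedType.Exports.

Local Open Scope classical_set_scope.
Local Open Scope ring_scope.

Definition inner (R : realType) (p : nat) (u v : 'cV[R]_p) : R :=
  \sum_(j < p) u j 0 * v j 0.

(* The library norm on matrices is the sup norm, hence a separate Euclidean
   norm. Both induce the same topology, so limits use the library topology. *)
Definition enorm (R : realType) (p : nat) (u : 'cV[R]_p) : R :=
  Num.sqrt (inner u u).

(* Largest modulus of a complex eigenvalue; it is 0 when [p = 0]. *)
Definition spectral_radius (R : realType) (p : nat) (M : 'M[R]_p) : R :=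
  sup [set complex.Re `|z| |
       z in [set z : R[i] | eigenvalue (map_mx (real_complex R) M) z]].

Definition argmin (R : realType) (T : Type) (D : set T) (g : T -> R) : set T :=
  [set u | D u /\ forall v, D v -> g u <= g v].

Definition closed_function (R : realType) (p : nat) (g : 'cV[R]_p -> R) :=
  closed [set z : 'cV[R]_p * R | g z.1 <= z.2].

(* [forall i, 'cV_(n i)] is R^{n_1} x ... x R^{n_m}, with the blocks indexed
   from 0 by ['I_m]; ['I_m -> 'cV_l] is (R^l)^m. *)
Definition blocks (R : realType) (m : nat) (n : 'I_m -> nat) :=
  forall i : 'I_m, 'cV[R]_(n i).

Definition prod_set (R : realType) (m : nat) (n : 'I_m -> nat)
    (X : forall i, set 'cV[R]_(n i)) : set (blocks R n) :=
  [set x | forall i, X i (x i)].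

Definition zero_sum (R : realType) (m l : nat) : set ('I_m -> 'cV[R]_l) :=
  [set y | \sum_(i < m) y i = 0].
Arguments zero_sum : clear implicits.

Definition total_obj (R : realType) (m : nat) (n : 'I_m -> nat)
    (f : forall i, 'cV[R]_(n i) -> R) (x : blocks R n) : R :=
  \sum_(i < m) f i (x i).

Definition lagrangian (R : realType) (m l : nat) (n : 'I_m -> nat)
    (f : forall i, 'cV[R]_(n i) -> R) (A : forall i, 'M[R]_(l, n i))
    (b : 'cV[R]_l) (x : blocks R n) (lam : 'cV[R]_l) : R :=
  total_obj f x - inner lam (\sum_(i < m) A i *m x i - b).

Definition saddle_point (R : realType) (m l : nat) (n : 'I_m -> nat)
    (f : forall i, 'cV[R]_(n i) -> R) (X : forall i, set 'cV[R]_(n i))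
    (A : forall i, 'M[R]_(l, n i)) (b : 'cV[R]_l)
    (xs : blocks R n) (ls : 'cV[R]_l) : Prop :=
  [/\ prod_set X xs,
      forall lam, lagrangian f A b xs lam <= lagrangian f A b xs ls
    & forall x, prod_set X x ->
        lagrangian f A b xs ls <= lagrangian f A b x ls].

Definition split_feasible (R : realType) (m l : nat) (n : 'I_m -> nat)
    (X : forall i, set 'cV[R]_(n i)) (A : forall i, 'M[R]_(l, n i))
    (b : 'cV[R]_l) : set (blocks R n * ('I_m -> 'cV[R]_l)) :=
  [set z | [/\ prod_set X z.1, zero_sum R m l z.2
             & forall i, A i *m z.1 i - m%:R^-1 *: b = z.2 i]].

Definition split_optimal (R : realType) (m l : nat) (n : 'I_m -> nat)
    (f : forall i, 'cV[R]_(n i) -> R) (X : forall i, set 'cV[R]_(n i))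
    (A : forall i, 'M[R]_(l, n i)) (b : 'cV[R]_l)
    : set (blocks R n * ('I_m -> 'cV[R]_l)) :=
  argmin (split_feasible X A b) (fun z => total_obj f z.1).

Definition split_value (R : realType) (m l : nat) (n : 'I_m -> nat)
    (f : forall i, 'cV[R]_(n i) -> R) (X : forall i, set 'cV[R]_(n i))
    (A : forall i, 'M[R]_(l, n i)) (b : 'cV[R]_l) : \bar R :=
  ereal_inf [set (total_obj f z.1)%:E | z in split_feasible X A b].

Definition split_lagrangian (R : realType) (m l : nat) (n : 'I_m -> nat)
    (f : forall i, 'cV[R]_(n i) -> R) (A : forall i, 'M[R]_(l, n i))
    (b : 'cV[R]_l) (x : blocks R n) (y lam : 'I_m -> 'cV[R]_l) : R :=
  total_obj f x
  - \sum_(i < m) inner (lam i) (A i *m x i - m%:R^-1 *: b - y i).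

Definition split_dual (R : realType) (m l : nat) (n : 'I_m -> nat)
    (f : forall i, 'cV[R]_(n i) -> R) (X : forall i, set 'cV[R]_(n i))
    (A : forall i, 'M[R]_(l, n i)) (b : 'cV[R]_l)
    (lam : 'I_m -> 'cV[R]_l) : \bar R :=
  ereal_inf [set (split_lagrangian f A b z.1 z.2 lam)%:E |
             z in prod_set X `*` zero_sum R m l].

Definition split_dual_optimal (R : realType) (m l : nat) (n : 'I_m -> nat)
    (f : forall i, 'cV[R]_(n i) -> R) (X : forall i, set 'cV[R]_(n i))
    (A : forall i, 'M[R]_(l, n i)) (b : 'cV[R]_l)
    (lam : 'I_m -> 'cV[R]_l) : Prop :=
  forall mu : 'I_m -> 'cV[R]_l,
    (split_dual f X A b mu <= split_dual f X A b lam)%E.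

Definition y_step (R : realType) (m l : nat) (n : 'I_m -> nat)
    (A : forall i, 'M[R]_(l, n i)) (b : 'cV[R]_l) (beta : R)
    (x : blocks R n) (lam : 'I_m -> 'cV[R]_l) : set ('I_m -> 'cV[R]_l) :=
  argmin (zero_sum R m l) (fun y => beta / 2 *
    \sum_(i < m)
      enorm (A i *m x i - m%:R^-1 *: b - y i - beta^-1 *: lam i) ^+ 2).

(* One block: [M], [c], [v], [mu] stand for A_i, b / m, y_i^{k+1}, lambda_i^k. *)
Definition x_step_exact (R : realType) (p l : nat) (g : 'cV[R]_p -> R)
    (D : set 'cV[R]_p) (M : 'M[R]_(l, p)) (c : 'cV[R]_l) (beta : R)
    (v mu : 'cV[R]_l) : set 'cV[R]_p :=
  argmin D (fun u => g u
    + beta / 2 * enorm (M *m u - c - v - beta^-1 *: mu) ^+ 2).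

(* [u0] stands for x_i^k and [tau] for tau_i. *)
Definition x_step_prox (R : realType) (p l : nat) (g : 'cV[R]_p -> R)
    (D : set 'cV[R]_p) (M : 'M[R]_(l, p)) (c : 'cV[R]_l) (beta tau : R)
    (u0 : 'cV[R]_p) (v mu : 'cV[R]_l) : set 'cV[R]_p :=
  argmin D (fun u => g u
    + inner (beta *: (M^T *m (M *m u0 - c - v - beta^-1 *: mu))) (u - u0)
    + tau / 2 * enorm (u - u0) ^+ 2).

(* [exact i] selects, once and for all iterations, how the subproblem of block
   [i] is solved; [tau i] is only used when [exact i] is false. *)
Definition psadmm (R : realType) (m l : nat) (n : 'I_m -> nat)
    (f : forall i, 'cV[R]_(n i) -> R) (X : forall i, set 'cV[R]_(n i))
    (A : forall i, 'M[R]_(l, n i)) (b : 'cV[R]_l) (beta : R)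
    (exact : 'I_m -> bool) (tau : 'I_m -> R)
    (x : nat -> blocks R n) (y lam : nat -> 'I_m -> 'cV[R]_l) : Prop :=
  forall k : nat,
    [/\ y_step A b beta (x k) (lam k) (y k.+1),
        forall i, if exact i
          then x_step_exact (f i) (X i) (A i) (m%:R^-1 *: b) beta
                 (y k.+1 i) (lam k i) (x k.+1 i)
          else x_step_prox (f i) (X i) (A i) (m%:R^-1 *: b) beta (tau i)
                 (x k i) (y k.+1 i) (lam k i) (x k.+1 i)
      & forall i, lam k.+1 i =
          lam k i - beta *: (A i *m x k.+1 i - m%:R^-1 *: b - y k.+1 i)].

(* Main.v *)
(* Each x-step satisfies a variational inequality in which [lambda^{k+1}] appears
   as the multiplier, up to a term in the metric [P_i = tau_i I - beta A_i^T A_i]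
   (proximal step, positive definite because [|A_i u|^2 <= rho(A_i^T A_i) |u|^2])
   or [P_i = 0] (exact step). Combined with the y-step, it yields that
     sum_i |lambda_i^k - lambda_i|^2 / beta + beta |A_i x_i^k - a_i|^2
           + |x_i^k - z_i|_{P_i}^2
   plus the squared [P]-length of the last x-increment is nonincreasing, for any
   primal-dual reference point [(a, z, lambda)]. The saddle point as reference
   gives boundedness and vanishing increments, hence convergence of the
   objective and of the residuals; a cluster point of the iterates as reference
   then gives convergence of the iterates themselves (Fejer monotonicity). *)
Require Import Defs.
From HB Require Import structures.
From mathcomp Require Import all_boot all_order all_algebra.
From mathcomp Require Import all_classical all_reals all_analysis.
From mathcomp Require Import complex ring lra.
Set Implicit Arguments.
Unset Strict Implicit.
Unset Printing Implicit Defensive.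
Import Order.TTheory GRing.Theory Num.Theory.
Import numFieldNormedType.Exports.
Local Open Scope classical_set_scope.
Local Open Scope ring_scope.

(** * Inner product, quadratic forms and convergence *)

Section InnerProduct.
Variables (R : realType) (p : nat).
Implicit Types (u v w : 'cV[R]_p) (t : R).

Lemma innerC u v : inner u v = inner v u.
Proof. by apply: eq_bigr => j _; rewrite mulrC. Qed.

Lemma innerDl u v w : inner (u + v) w = inner u w + inner v w.
Proof. by rewrite -big_split; apply: eq_bigr => j _; rewrite mxE mulrDl. Qed.

Lemma innerDr u v w : inner u (v + w) = inner u v + inner u w.
Proof. by rewrite innerC innerDl !(innerC u). Qed.

Lemma innerZl t u v : inner (t *: u) v = t * inner u v.
Proof. by rewrite mulr_sumr; apply: eq_bigr => j _; rewrite mxE mulrA. Qed.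

Lemma innerZr t u v : inner u (t *: v) = t * inner u v.
Proof. by rewrite innerC innerZl innerC. Qed.

Lemma innerNl u v : inner (- u) v = - inner u v.
Proof. by rewrite -scaleN1r innerZl mulN1r. Qed.

Lemma innerNr u v : inner u (- v) = - inner u v.
Proof. by rewrite innerC innerNl innerC. Qed.

Lemma inner0l u : inner 0 u = 0.
Proof. by rewrite -(scale0r 0) innerZl mul0r. Qed.

Lemma inner0r u : inner u 0 = 0.
Proof. by rewrite innerC inner0l. Qed.

Lemma inner_ge0 u : 0 <= inner u u.
Proof. by apply: sumr_ge0 => j _; rewrite -expr2 sqr_ge0. Qed.

Lemma sqr_coord_le_inner u j : u j 0 ^+ 2 <= inner u u.
Proof.
rewrite /inner (bigD1 j)//= -expr2 lerDl.
by apply: sumr_ge0 => i _; rewrite -expr2 sqr_ge0.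
Qed.

Lemma inner_eq0 u : inner u u = 0 -> u = 0.
Proof.
move=> u0; apply/matrixP => j k; rewrite (ord1 k) mxE; apply/eqP.
by rewrite -sqrf_eq0 eq_le sqr_ge0 -u0 sqr_coord_le_inner.
Qed.

Lemma enorm_sqr u : enorm u ^+ 2 = inner u u.
Proof. by rewrite sqr_sqrtr// inner_ge0. Qed.

End InnerProduct.

Definition innerE := (innerDl, innerDr, innerNl, innerNr, innerZl, innerZr).

Lemma sqr_innerD_le (R : realType) (p : nat) (u v : 'cV[R]_p) :
  inner (u + v) (u + v) <= 2 * inner u u + 2 * inner v v.
Proof. by have := inner_ge0 (u - v); rewrite !innerE (innerC v u); lra. Qed.

Lemma inner_sumr (R : realType) (p : nat) (I : finType) (u : 'cV[R]_p)
    (v : I -> 'cV[R]_p) : inner u (\sum_i v i) = \sum_i inner u (v i).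
Proof.
rewrite exchange_big; apply: eq_bigr => j _ /=.
by rewrite summxE mulr_sumr.
Qed.

Lemma inner_mulmx (R : realType) (p q : nat) (M : 'M[R]_(p, q)) u v :
  inner (M *m u) v = inner u (M^T *m v).
Proof.
transitivity (\sum_j \sum_i M j i * u i 0 * v j 0).
  by apply: eq_bigr => j _; rewrite mxE mulr_suml.
rewrite exchange_big; apply: eq_bigr => i _; rewrite mxE mulr_sumr.
by apply: eq_bigr => j _; rewrite mxE mulrA (mulrC (u i 0)).
Qed.

(** * Nonnegative quadratics in one variable and semidefinite forms *)

Section QuadraticForms.
Variable R : realType.

Lemma quadratic_ge0_slope (a c : R) :
  (forall t, 0 < t -> t <= 1 -> 0 <= t * a + t ^+ 2 * c) -> 0 <= a.
Proof.
move=> h; rewrite leNgt; apply/negP => a0.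
have m0 : 0 < `|c| - a + 1 by rewrite ltr_wpDl// addr_ge0// oppr_ge0 ltW.
(* For [a < 0] this step lies in [(0, 1]] and is so short that [t * |c| < - a], which makes
   [a + t * c] negative. *)
have t0 : 0 < - a / (`|c| - a + 1) by rewrite divr_gt0// oppr_gt0.
have := h _ t0; set t := - a / _ in t0 *.
have ht : t * (`|c| - a + 1) = - a by rewrite /t divfK// gt_eqF.
have t1 : t <= 1.
  by rewrite /t ler_pdivrMr// mul1r -subr_ge0 opprK addrAC subrK addr_ge0.
move=> /(_ t1); have -> : t * a + t ^+ 2 * c = t * (a + t * c) by ring.
rewrite pmulr_rge0//.
have : t * c <= t * `|c| by rewrite ler_pM2l// ler_norm.
have := normr_ge0 c; nra.
Qed.

Lemma discriminant_le (a b c : R) : 0 <= c ->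
  (forall t, 0 <= a + 2 * t * b + t ^+ 2 * c) -> b ^+ 2 <= a * c.
Proof.
rewrite le_eqVlt => /predU1P[<-|c0] h.
  have [->|b0] := eqVneq b 0; first by rewrite expr0n mulr0.
  (* With [c = 0] the function is affine in [t]; at this point it takes the value [-1]. *)
  have := h (- (a + 1) / (2 * b)).
  have -> : a + 2 * (- (a + 1) / (2 * b)) * b + (- (a + 1) / (2 * b)) ^+ 2 * 0
    = -1 by field.
  by rewrite oppr_ge0 ler10.
(* The minimizer of the quadratic. *)
have := h (- b / c).
have -> : a + 2 * (- b / c) * b + (- b / c) ^+ 2 * c = (a * c - b ^+ 2) / c.
  by field; rewrite gt_eqF.
by rewrite pmulr_lge0 ?invr_gt0// subr_ge0.
Qed.

(** Discriminant of the form evaluated at [u + t *: v]. Since [Q] may be singular, this covers the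
    zero metric of exact blocks as well as the proximal metrics. *)
Lemma cauchy_schwarz_psd (p : nat) (Q : 'M[R]_p) :
    Q^T = Q -> (forall u, 0 <= inner (Q *m u) u) -> forall u v,
  inner (Q *m u) v ^+ 2 <= inner (Q *m u) u * inner (Q *m v) v.
Proof.
move=> Qs Qp u v; apply: discriminant_le => // t.
have -> : inner (Q *m u) u + 2 * t * inner (Q *m u) v + t ^+ 2 * inner (Q *m v) v
    = inner (Q *m (u + t *: v)) (u + t *: v); last exact: Qp.
rewrite mulmxDr -scalemxAr !innerE (inner_mulmx Q v u) Qs (innerC v).
by ring.
Qed.

End QuadraticForms.

Lemma ler_sum_term (R : numDomainType) (I : finType) (g : I -> R) (i : I) :
  (forall j, 0 <= g j) -> g i <= \sum_j g j.
Proof. by move=> g0; rewrite (bigD1 i)//= lerDl sumr_ge0. Qed.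

(** * Limits along filters, and compactness by ultrafilters *)

Section Convergence.
Variable R : realType.

Section Filters.
Context {T : Type} {F : set_system T} {FF : Filter F}.

Lemma cvg_colP p (u : T -> 'cV[R]_p) (a : 'cV[R]_p) :
  u k @[k --> F] --> a <-> forall j, u k j 0 @[k --> F] --> a j 0.
Proof.
split=> [ua j|ua].
  apply: (cvg_comp u (fun M : 'cV[R]_p => M j 0) ua).
  exact: coord_continuous.
apply/cvgrPdist_lt => e e0.
have : \forall k \near F, forall j : 'I_p, `|a j 0 - u k j 0| < e.
  apply: filter_forall => j.
  by move: (ua j) => /cvgrPdist_lt; apply.
apply: filterS => k hk.
rewrite [ltLHS]/Num.Def.normr/= mx_normrE; apply/bigmax_ltP; split => // -[i j] _ /=.
by rewrite (ord1 j) !mxE; apply: hk.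
Qed.

Lemma cvg_sumr (V : normedModType R) (I : finType) (g : I -> T -> V)
    (c : I -> V) :
  (forall i, g i k @[k --> F] --> c i) ->
  (\sum_i g i k) @[k --> F] --> \sum_i c i.
Proof.
move=> h; apply: cvg_big => //; exact: add_continuous.
Qed.

Lemma cvg_sumr0 (V : normedModType R) (I : finType) (g : I -> T -> V) :
  (forall i, g i k @[k --> F] --> (0 : V)) ->
  (\sum_i g i k) @[k --> F] --> (0 : V).
Proof. by move=> h; have := cvg_sumr h; rewrite big1. Qed.

Lemma cvg_inner p (u v : T -> 'cV[R]_p) (a b : 'cV[R]_p) :
  u k @[k --> F] --> a -> v k @[k --> F] --> b ->
  inner (u k) (v k) @[k --> F] --> inner a b.
Proof.
move=> /cvg_colP ua /cvg_colP vb; apply: cvg_sumr => j.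
exact: cvgM.
Qed.

Lemma cvg_mulmxr p q (M : 'M[R]_(q, p)) (u : T -> 'cV[R]_p) (a : 'cV[R]_p) :
  u k @[k --> F] --> a -> M *m u k @[k --> F] --> M *m a.
Proof.
move=> /cvg_colP ua; apply/cvg_colP => j; rewrite mxE.
under eq_fun do rewrite mxE.
by apply: cvg_sumr => i; apply: cvgMr; apply: ua.
Qed.

Lemma squeeze_cvg0 (g h : T -> R) : (forall k, 0 <= g k <= h k) ->
  h k @[k --> F] --> 0 -> g k @[k --> F] --> 0.
Proof.
move=> gh h0; apply: (@squeeze_cvgr _ _ _ _ (cst 0) h) h0.
  by apply: nearW => k; apply: gh.
exact: cvg_cst.
Qed.

Lemma sqr_cvg0 (g : T -> R) : g k ^+ 2 @[k --> F] --> 0 -> g k @[k --> F] --> 0.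
Proof.
move=> g2; apply: norm_cvg0.
under eq_fun do rewrite -sqrtr_sqr.
have : Num.sqrt (g k ^+ 2) @[k --> F] --> Num.sqrt (0 : R).
  by apply: (cvg_comp _ Num.sqrt g2); apply: sqrt_continuous.
by rewrite sqrtr0.
Qed.

Lemma inner_cvg0 p (u : T -> 'cV[R]_p) :
  inner (u k) (u k) @[k --> F] --> 0 -> u k @[k --> F] --> (0 : 'cV[R]_p).
Proof.
move=> u0; apply/cvg_colP => j; rewrite mxE; apply: sqr_cvg0.
apply: squeeze_cvg0 u0 => k.
by rewrite sqr_ge0 sqr_coord_le_inner.
Qed.

(** Cauchy-Schwarz for [Q]. Only the seminorm of [Q] is controlled, so [u] and [v] may be unbounded
    in its kernel. *)
Lemma psd_cvg0 p (Q : 'M[R]_p) (u v : T -> 'cV[R]_p) (C : R) :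
  Q^T = Q -> (forall u, 0 <= inner (Q *m u) u) ->
  inner (Q *m u k) (u k) @[k --> F] --> 0 ->
  (forall k, inner (Q *m v k) (v k) <= C) ->
  inner (Q *m u k) (v k) @[k --> F] --> 0.
Proof.
move=> Qs Qp u0 vC; apply: sqr_cvg0.
apply: (@squeeze_cvg0 _ (fun k => inner (Q *m u k) (u k) * C)).
  move=> k; rewrite sqr_ge0/=; apply: le_trans (cauchy_schwarz_psd Qs Qp _ _) _.
  by rewrite ler_wpM2l.
have : inner (Q *m u k) (u k) * C @[k --> F] --> 0 * C by apply: cvgMl.
by rewrite mul0r.
Qed.

Lemma inner_bounded_cvg0 p (u v : T -> 'cV[R]_p) (C : R) :
  u k @[k --> F] --> (0 : 'cV[R]_p) -> (forall k, inner (v k) (v k) <= C) ->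
  inner (u k) (v k) @[k --> F] --> 0.
Proof.
move=> u0 vC.
under eq_fun do rewrite -(mul1mx (u _)).
apply: (@psd_cvg0 _ _ _ _ C).
- exact: trmx1.
- by move=> w; rewrite mul1mx inner_ge0.
- under eq_fun do rewrite mul1mx.
  by rewrite -(inner0l (0 : 'cV[R]_p)); apply: cvg_inner.
- by move=> k; rewrite mul1mx.
Qed.

End Filters.

Lemma ultra_fmap (T V : Type) (g : T -> V) (U : set_system T) :
  UltraFilter U -> UltraFilter (g @ U).
Proof.
move=> UU; apply: Build_UltraFilter => G GG sUG.
apply/seteqP; split => // B GB.
have [//|UnB] := in_ultra_setVsetC (g @^-1` B) UU.
have GnB : G (~` B) by exact: sUG.
by have /filter_ex[z []] : G (B `&` ~` B) by exact: filterI.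
Qed.

(** Bolzano-Weierstrass without subsequences: each coordinate stays in a compact segment, where the
    image ultrafilter has a limit. One ultrafilter then serves all blocks and all sequences at
    once. *)
Lemma ultra_bounded_cvg (T : Type) (U : set_system T) p (u : T -> 'cV[R]_p)
    (C : R) : UltraFilter U -> (\forall k \near U, inner (u k) (u k) <= C) ->
  exists a : 'cV[R]_p, u k @[k --> U] --> a.
Proof.
move=> UU uC.
have h j : exists a : R, u k j 0 @[k --> U] --> a.
  (* A squared coordinate at most [C] has modulus at most [C + 1], which avoids a square root. *)
  have := @segment_compact R (- (C + 1)) (C + 1).
  rewrite compact_ultra => /(_ ((fun k => u k j 0) @ U)) [].
    exact: ultra_fmap.
    apply: filterS uC => k ukC /=; rewrite in_itv/= -ler_norml.
    have hC : `|u k j 0| ^+ 2 <= C.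
      rewrite real_normK ?num_real//.
      by apply: le_trans ukC; exact: sqr_coord_le_inner.
    have := normr_ge0 (u k j 0); nra.
  by move=> a [_ ha]; exists a.
have [a ha] := choice h.
by exists (\col_j a j); apply/cvg_colP => j; rewrite mxE.
Qed.

End Convergence.

(** * First-order optimality of the subproblems *)

Lemma convex_function_segment (R : realType) (p : nat) (g : 'cV[R]_p -> R)
    (u v : 'cV[R]_p) (t : R) :
  convex_function setT g -> 0 <= t -> t <= 1 ->
  g (u + t *: (v - u)) <= g u + t * (g v - g u).
Proof.
move=> gc t0 t1.
have /= := gc (Itv01 t0 t1) v u (in_setT _) (in_setT _).
rewrite /conv/= => h; apply: le_trans (le_trans h _).
  by rewrite /unstable.onem scalerBl scale1r scalerBr addrCA.
rewrite [leLHS](_ : _ = t * g v + (1 - t) * g u); last by [].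
by lra.
Qed.

Lemma convex_set_segment (R : realType) (p : nat) (D : set 'cV[R]_p)
    (u v : 'cV[R]_p) (t : R) :
  convex_set D -> 0 <= t -> t <= 1 -> D u -> D v -> D (u + t *: (v - u)).
Proof.
move=> Dc t0 t1 /mem_set Du /mem_set Dv.
have := Dc v u (Itv01 t0 t1) Dv Du; rewrite inE/= /conv/=.
by rewrite /unstable.onem scalerBl scale1r scalerBr addrCA.
Qed.

(** Move from [u] towards [v] by a fraction [t]: convexity bounds the change of [g] by
    [t * (g v - g u)], while [h] is exactly quadratic, with linear part [s]. Dividing by [t] and
    letting it tend to 0 requires no derivative of [g]. *)
Lemma argmin_first_order (R : realType) (p : nat) (g : 'cV[R]_p -> R)
    (D : set 'cV[R]_p) (h s c : 'cV[R]_p -> R) (u v : 'cV[R]_p) :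
  convex_function setT g -> convex_set D ->
  argmin D (fun w => g w + h w) u ->
  (forall w t, h (u + t *: w) = h u + t * s w + t ^+ 2 * c w) ->
  D v -> 0 <= g v - g u + s (v - u).
Proof.
move=> gc Dc [Du umin] hE Dv.
apply: (@quadratic_ge0_slope _ _ (c (v - u))) => t t0 t1.
have := umin _ (convex_set_segment Dc (ltW t0) t1 Du Dv).
have := convex_function_segment u v gc (ltW t0) t1.
by rewrite hE; lra.
Qed.

(** The vector [mu - beta *: (M *m u - c - v)] is the updated multiplier when [u] is the new
    iterate. *)
Lemma x_step_exact_first_order (R : realType) (p l : nat) (g : 'cV[R]_p -> R)
    (D : set 'cV[R]_p) (M : 'M[R]_(l, p)) (c : 'cV[R]_l) (beta : R)
    (v mu : 'cV[R]_l) (u w : 'cV[R]_p) :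
  beta != 0 -> convex_function setT g -> convex_set D ->
  x_step_exact g D M c beta v mu u -> D w ->
  0 <= g w - g u - inner (mu - beta *: (M *m u - c - v)) (M *m (w - u)).
Proof.
move=> b0 gc Dc umin Dw; rewrite -innerNl.
apply: (argmin_first_order (c := fun w => beta / 2 * inner (M *m w) (M *m w))
  (s := fun w => inner (- (mu - beta *: (M *m u - c - v))) (M *m w))
  gc Dc umin _ Dw) => z t.
rewrite !enorm_sqr mulmxDr -scalemxAr !innerE !(innerC (M *m z)).
by field.
Qed.

(** The step uses the gradient at [u0]; replacing it by the one at [u], so that the updated
    multiplier appears, changes [tau] into the metric [tau%:M - beta *: (M^T *m M)]. *)
Lemma x_step_prox_first_order (R : realType) (p l : nat) (g : 'cV[R]_p -> R)
    (D : set 'cV[R]_p) (M : 'M[R]_(l, p)) (c : 'cV[R]_l) (beta tau : R)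
    (u0 : 'cV[R]_p) (v mu : 'cV[R]_l) (u w : 'cV[R]_p) :
  beta != 0 -> convex_function setT g -> convex_set D ->
  x_step_prox g D M c beta tau u0 v mu u -> D w ->
  0 <= g w - g u - inner (mu - beta *: (M *m u - c - v)) (M *m (w - u))
       + inner ((tau%:M - beta *: (M^T *m M)) *m (u - u0)) (w - u).
Proof.
move=> b0 gc Dc umin Dw; rewrite -addrA -innerNl.
pose h z := inner (beta *: (M^T *m (M *m u0 - c - v - beta^-1 *: mu))) (z - u0)
    + tau / 2 * enorm (z - u0) ^+ 2.
have {}umin : argmin D (fun z => g z + h z) u.
  by case: umin => Du um; split=> // z Dz; rewrite !addrA; exact: um.
apply: (argmin_first_order (c := fun w => tau / 2 * inner w w)
  (s := fun w => inner (- (mu - beta *: (M *m u - c - v))) (M *m w)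
     + inner ((tau%:M - beta *: (M^T *m M)) *m (u - u0)) w)
  gc Dc umin _ Dw) => z t.
rewrite /h !enorm_sqr mulmxBl mul_scalar_mx -scalemxAl -mulmxA.
rewrite !innerE !(inner_mulmx M^T) trmxK !(mulmxDr, mulmxN) !innerE.
rewrite (innerC z u) (innerC z u0) (innerC u0 u).
by field.
Qed.

(** The zero-sum families form a linear space, so [y] can be moved along [d] and along [- d]; both
    slopes are nonnegative. *)
Lemma y_step_orthogonal (R : realType) (m l : nat) (n : 'I_m -> nat)
    (A : forall i, 'M[R]_(l, n i)) (b : 'cV[R]_l) (beta : R)
    (x : blocks R n) (lam y d : 'I_m -> 'cV[R]_l) :
  0 < beta -> y_step A b beta x lam y -> zero_sum R m l d ->
  \sum_i inner (lam i - beta *: (A i *m x i - m%:R^-1 *: b - y i)) (d i) = 0.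
Proof.
move=> b0 [y0 ymin] d0.
pose r i := lam i - beta *: (A i *m x i - m%:R^-1 *: b - y i).
have quad t : 0 <= t * \sum_i inner (r i) (d i)
    + t ^+ 2 * (beta / 2 * \sum_i inner (d i) (d i)).
  have yd0 : zero_sum R m l (fun i => y i + t *: d i).
    by rewrite /zero_sum/= big_split/= y0 -scaler_sumr d0 scaler0 addr0.
  have := ymin _ yd0; rewrite -subr_ge0 => /le_trans; apply.
  rewrite le_eqVlt; apply/orP; left; apply/eqP.
  rewrite !mulr_sumr -sumrB -big_split/=; apply: eq_bigr => i _.
  rewrite /r opprD addrA; move: (_ - y i) => z.
  rewrite !enorm_sqr !innerE !(innerC (d i)) !(innerC z (lam i)).
  by field; rewrite gt_eqF.
apply/eqP; rewrite eq_le; apply/andP; split; last first.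
  by apply: quadratic_ge0_slope => t _ _; exact: quad.
rewrite -oppr_ge0; apply: quadratic_ge0_slope => t _ _.
by have := quad (- t); rewrite sqrrN mulNr mulrN; apply.
Qed.

(** * Spectral radius and the proximal metric *)

Section SpectralRadius.
Variable R : realType.

Lemma compact_sphere p : compact [set u : 'cV[R]_p | inner u u = 1].
Proof.
rewrite compact_ultra => U UU U1.
have [a Ua] : exists a : 'cV[R]_p, id k @[k --> U] --> a.
  by apply: (ultra_bounded_cvg (C := 1)); apply: filterS U1 => u ->.
have UF : ProperFilter U by exact: ultra_proper.
exists a; split => //=.
have Uaa : inner u u @[u --> U] --> inner a a by exact: cvg_inner.
apply/eqP; rewrite eq_le; apply/andP; split.
  by apply: (cvgr_to_le Uaa); apply: filterS U1 => u /= ->.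
by apply: (cvgr_to_ge Uaa); apply: filterS U1 => u /= ->.
Qed.

(** The supremum bounds its set only if that set is bounded above; the eigenvalues are the finitely
    many roots of the characteristic polynomial, so the sum of their moduli is an upper bound. *)
Lemma le_spectral_radius p (M : 'M[R]_p) (z : R[i]) :
  eigenvalue (map_mx (real_complex R) M) z ->
  complex.Re `|z| <= spectral_radius M.
Proof.
move=> Mz; apply: ub_le_sup; last by exists z.
have [r pr] := closed_field_poly_normal (char_poly (map_mx (real_complex R) M)).
have ge0 (w : R[i]) : 0 <= complex.Re `|w|.
  by have := normr_ge0 w; rewrite lecE => /andP[].
exists (\sum_(w <- r) complex.Re `|w|) => _ [w /= Mw <-].
have : w \in r.
  move: Mw; rewrite eigenvalue_root_char pr.
  rewrite (monicP (char_poly_monic _)) scale1r.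
  by rewrite root_prod_XsubC.
move=> wr; rewrite (big_rem _ wr)/= lerDl.
by apply: sumr_ge0 => y _; exact: ge0 y.
Qed.

(* At a maximizer of |Mu|^2 over the unit sphere, first-order optimality makes
   the maximum an eigenvalue of M^T M. *)
Lemma inner_mulmx_le_spectral_radius p l (M : 'M[R]_(l, p)) (u : 'cV[R]_p) :
  inner (M *m u) (M *m u) <= spectral_radius (M^T *m M) * inner u u.
Proof.
have [->|u0] := eqVneq u 0; first by rewrite mulmx0 !inner0l mulr0.
have pos (w : 'cV[R]_p) : w != 0 -> 0 < inner w w.
  move=> w0; rewrite lt_neqAle inner_ge0 andbT eq_sym.
  by apply: contra_neq w0; exact: inner_eq0.
pose nrm (w : 'cV[R]_p) := (Num.sqrt (inner w w))^-1 *: w.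
have nrm1 w : w != 0 -> inner (nrm w) (nrm w) = 1.
  move=> w0; rewrite !innerE mulrA -expr2 exprVn sqr_sqrtr ?inner_ge0//.
  by rewrite mulVf// gt_eqF ?pos.
have [v v1 vmax] : exists2 v : 'cV[R]_p, inner v v = 1 & forall w,
    inner w w = 1 -> inner (M *m w) (M *m w) <= inner (M *m v) (M *m v).
  have [||v] := @compact_EVT_max _ _ (fun w => inner (M *m w) (M *m w)) _ _
    (@compact_sphere p).
  - by exists (nrm u); rewrite /= nrm1.
  - apply: continuous_subspaceT => w.
    have Mw : M *m z @[z --> w] --> M *m w.
      exact: (@cvg_mulmxr _ _ _ (nbhs_filter w) _ _ M id w cvg_id).
    exact: (@cvg_inner _ _ _ (nbhs_filter w) _ _ _ _ _ Mw Mw).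
  - rewrite inE/= => v1 vmax; exists v => // w w1; apply: vmax.
    by rewrite inE.
set mu := inner (M *m v) (M *m v) in vmax.
have q0 (w : 'cV[R]_p) : inner (M *m w) (M *m w) <= mu * inner w w.
  have [->|w0] := eqVneq w 0; first by rewrite mulmx0 !inner0l mulr0.
  have := vmax _ (nrm1 _ w0); rewrite -scalemxAr !innerE mulrA -expr2.
  by rewrite exprVn sqr_sqrtr ?inner_ge0// ler_pdivrMl ?pos// mulrC.
apply: le_trans (q0 u) _; rewrite ler_pM2r ?pos//.
(* The form [mu * inner w w - inner (M *m w) (M *m w)] is nonnegative and vanishes at [v]; the
   discriminant bound with constant term 0 kills its linear part at [v]. *)
have orth w : inner (mu *: v - M^T *m M *m v) w = 0.
  have b2 := @discriminant_le R 0 (inner (mu *: v - M^T *m M *m v) w)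
    (mu * inner w w - inner (M *m w) (M *m w)).
  apply/eqP; rewrite -sqrf_eq0 eq_le sqr_ge0 andbT -[leRHS](mul0r
    (mu * inner w w - inner (M *m w) (M *m w))).
  apply: b2 => [|t]; first by rewrite subr_ge0.
  have := q0 (v + t *: w); rewrite -subr_ge0.
  rewrite -mulmxA mulmxDr -scalemxAr !innerE (inner_mulmx M^T) trmxK.
  rewrite v1 -/mu (innerC w v) (innerC (M *m w)).
  by congr (_ <= _); ring.
have eig : M^T *m M *m v = mu *: v.
  apply/esym/eqP; rewrite -subr_eq0; apply/eqP; apply: inner_eq0.
  exact: orth.
have mu0 : 0 <= mu by exact: inner_ge0.
have := @le_spectral_radius _ (M^T *m M) (real_complex R mu).
rewrite normc_def/= expr0n addr0 sqrtr_sqr ger0_norm//; apply.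
(* Eigenvectors are rows here; symmetry of [M^T *m M] allows transposing [v]. *)
apply/eigenvalueP; exists (map_mx (real_complex R) v^T).
  rewrite -map_mxM -map_mxZ -linearZ/= -eig; congr map_mx.
  by rewrite !trmx_mul trmxK mulmxA.
rewrite map_mx_eq0 trmx_eq0; apply: contra_eq_neq v1 => ->.
by rewrite inner0l eq_sym oner_eq0.
Qed.

Lemma prox_form_ge p l (M : 'M[R]_(l, p)) (beta tau : R) (u : 'cV[R]_p) :
  0 <= beta ->
  (tau - beta * spectral_radius (M^T *m M)) * inner u u <=
  inner ((tau%:M - beta *: (M^T *m M)) *m u) u.
Proof.
move=> b0; rewrite mulmxBl mul_scalar_mx -scalemxAl -mulmxA !innerE.
rewrite inner_mulmx trmxK mulrBl -mulrA lerD2l lerN2.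
by rewrite ler_wpM2l// inner_mulmx_le_spectral_radius.
Qed.

End SpectralRadius.

(** * Lyapunov function of the splitting iteration *)

(* [e], [q], [s] are the errors of lambda, A x and x with respect to a reference
   point, at iterations k (index 0) and k+1 (index 1). *)
Lemma lyapunov_block (R : realType) (p l : nat) (Q : 'M[R]_p) (beta : R)
    (e0 e1 q0 q1 : 'cV[R]_l) (s0 s1 : 'cV[R]_p) :
  beta != 0 -> Q^T = Q ->
  2 * (inner e1 q1 - inner (Q *m (s1 - s0)) s1)
    - 2 * inner (e1 + beta *: (q1 - q0)) (q1 - beta^-1 *: (e0 - e1)) =
  (beta^-1 * inner e0 e0 + beta * inner q0 q0 + inner (Q *m s0) s0)
  - (beta^-1 * inner e1 e1 + beta * inner q1 q1 + inner (Q *m s1) s1)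
  - (beta^-1 * inner (e1 - e0) (e1 - e0) + beta * inner (q1 - q0) (q1 - q0)
     + inner (Q *m (s1 - s0)) (s1 - s0))
  + 2 * inner (q1 - q0) (e0 - e1).
Proof.
move=> b0 Qs; rewrite !mulmxBr !innerE.
rewrite (inner_mulmx Q s1 s0) Qs (innerC s1 (Q *m s0)).
rewrite (innerC e1 e0) (innerC q1 q0) (innerC e1 q1).
by field.
Qed.

(** * Variational inequalities along the iterates and one-step descent *)

Section Algorithm.
Variables (R : realType) (m l : nat) (n : 'I_m -> nat).
Variables (f : forall i : 'I_m, 'cV[R]_(n i) -> R).
Variables (X : forall i : 'I_m, set 'cV[R]_(n i)).
Variables (A : forall i : 'I_m, 'M[R]_(l, n i)) (b : 'cV[R]_l).
Arguments f : clear implicits.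
Arguments X : clear implicits.
Variables (beta : R) (exact : 'I_m -> bool) (tau : 'I_m -> R).
Variables (x : nat -> blocks R n) (y lam : nat -> 'I_m -> 'cV[R]_l).
Hypothesis hf_convex : forall i : 'I_m, convex_function setT (f i).
Hypothesis hX_convex : forall i : 'I_m, convex_set (X i).
Hypothesis hbeta : 0 < beta.
Hypothesis htau : forall i : 'I_m, ~~ exact i ->
  beta * spectral_radius ((A i)^T *m A i) < tau i.
Hypothesis hgen : psadmm f X A b beta exact tau x y lam.

Let c : 'cV[R]_l := m%:R^-1 *: b.

(* The exact step satisfies the optimality condition of the proximal step with
   the proximal metric replaced by 0. *)
Definition metric i : 'M[R]_(n i) :=
  if exact i then 0 else (tau i)%:M - beta *: ((A i)^T *m A i).

Local Notation P := metric.

Lemma metric_sym i : (P i)^T = P i.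
Proof.
rewrite /metric; case: exact; first exact: trmx0.
by rewrite linearB linearZ/= tr_scalar_mx trmx_mul trmxK.
Qed.

Lemma metric_ge0 i u : 0 <= inner (P i *m u) u.
Proof.
rewrite /metric; case: (boolP (exact i)) => ei.
  by rewrite mul0mx inner0l.
apply: le_trans (prox_form_ge _ _ _ (ltW hbeta)).
by rewrite mulr_ge0 ?inner_ge0// subr_ge0 ltW// htau.
Qed.

Definition dx k i : 'cV[R]_(n i) := x k.+1 i - x k i.
Definition dAx k i : 'cV[R]_l := A i *m x k.+1 i - A i *m x k i.
Definition dlam k i : 'cV[R]_l := lam k.+1 i - lam k i.

Lemma x_in k i : X i (x k.+1 i).
Proof. by have [_ /(_ i) + _] := hgen k; case: ifP => _ []. Qed.

Lemma y_zero_sum k : zero_sum R m l (y k.+1).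
Proof. by have [[]] := hgen k. Qed.

Lemma residualE k i : A i *m x k.+1 i - c - y k.+1 i = - beta^-1 *: dlam k i.
Proof.
have [_ _ /(_ i) hl] := hgen k; rewrite /dlam hl.
rewrite -/c [X in - _ *: X]addrAC subrr add0r scalerN scaleNr opprK scalerA.
by rewrite mulVf ?scale1r// gt_eqF.
Qed.

Lemma block_first_order k i w : X i w ->
  0 <= f i w - f i (x k.+1 i) - inner (lam k.+1 i) (A i *m (w - x k.+1 i))
       + inner (P i *m dx k i) (w - x k.+1 i).
Proof.
move=> Xw; have [_ /(_ i) + /(_ i) ->] := hgen k; rewrite /metric.
have b0 : beta != 0 by rewrite gt_eqF.
case: ifP => _ hx.
  rewrite mul0mx inner0l addr0.
  exact: (x_step_exact_first_order b0 _ _ hx).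
exact: (x_step_prox_first_order b0 _ _ hx).
Qed.

Lemma total_first_order k w : prod_set X w ->
  0 <= total_obj f w - total_obj f (x k.+1)
    - \sum_i inner (lam k.+1 i) (A i *m w i - A i *m x k.+1 i)
    + \sum_i inner (P i *m dx k i) (w i - x k.+1 i).
Proof.
move=> Xw; rewrite -!sumrB -big_split/=; apply: sumr_ge0 => i _.
by rewrite -mulmxBr; apply: block_first_order.
Qed.

(** The y-step still involves the old [lam k] and [x k]; passing to the new multiplier leaves the
    correction [beta *: dAx k i]. *)
Lemma multiplier_orthogonal k d : zero_sum R m l d ->
  \sum_i inner (lam k.+1 i + beta *: dAx k i) (d i) = 0.
Proof.
move=> d0; have [hy _ hl] := hgen k.
rewrite -[RHS](y_step_orthogonal hbeta hy d0); apply: eq_bigr => i _.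
congr inner; rewrite hl /dAx.
move: (A i *m x k.+1 i) (A i *m x k i) (m%:R^-1 *: b) => p1 p0 c0.
by apply/matrixP => s t; rewrite !mxE; ring.
Qed.

Definition energy k : R := \sum_i (beta^-1 * inner (dlam k i) (dlam k i)
  + beta * inner (dAx k i) (dAx k i) + inner (P i *m dx k i) (dx k i)).

Definition step_norm k : R := \sum_i inner (P i *m dx k i) (dx k i).

(* Each of two consecutive x-steps is tested at the iterate of the other. *)
Lemma cross_term_le k :
  2 * \sum_i inner (dAx k.+1 i) (- dlam k.+1 i) <= step_norm k - step_norm k.+1.
Proof.
rewrite mulr_sumr -sumrB; apply: ler_sum => i _.
have h1 := block_first_order k.+1 (x_in k i).
have h2 := block_first_order k (x_in k.+1 i).
(* Bounds twice the mixed term of the two increments by the sum of their squared lengths. *)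
have h3 := metric_ge0 (dx k.+1 i - dx k i).
move: h1 h2 h3.
have -> : x k.+1 i - x k.+2 i = - dx k.+1 i by rewrite opprB.
rewrite -/(dx k.+1 i).
have -> : dAx k.+1 i = A i *m dx k.+1 i by rewrite mulmxBr.
rewrite /dlam; move: (dx k.+1 i) (dx k i) => d1 d0.
rewrite mulmxN mulmxBr !innerE (inner_mulmx (P i) d1 d0) metric_sym.
rewrite (innerC d1) !(innerC (A i *m _)).
by lra.
Qed.

(* The reference point keeps a limit [a i] of [A i *m x k i] separate from the
   limit [z i] of [x k i]: in an exactly solved block [x k i] may diverge, [a i]
   need not lie in the image of [X i], and [z i] is irrelevant since [P i = 0]. *)
Section Reference.
Variables (a : 'I_m -> 'cV[R]_l) (z : blocks R n) (mu : 'I_m -> 'cV[R]_l).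
Variable v : R.

Definition lyapunov k : R := \sum_i (
  beta^-1 * inner (lam k i - mu i) (lam k i - mu i)
  + beta * inner (A i *m x k i - a i) (A i *m x k i - a i)
  + inner (P i *m (x k i - z i)) (x k i - z i)).

Hypothesis primal_gap : forall k, 0 <= v - total_obj f (x k.+1)
  - \sum_i inner (lam k.+1 i) (a i - A i *m x k.+1 i)
  + \sum_i inner (P i *m dx k i) (z i - x k.+1 i).
Hypothesis dual_gap : forall k, 0 <= total_obj f (x k.+1) - v
  - \sum_i inner (mu i) (A i *m x k.+1 i - a i).
Hypothesis a_zero_sum : zero_sum R m l (fun i => a i - c).
Hypothesis mu_orthogonal : forall d, zero_sum R m l d ->
  \sum_i inner (mu i) (d i) = 0.

(** Adding the two gaps cancels the objective values and leaves a monotonicity inequality. Combined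
    with the orthogonality from the y-step it becomes, through [lyapunov_block], a descent up to one
    cross term. *)
Lemma lyapunov_step k : lyapunov k.+1 <=
  lyapunov k - energy k + 2 * \sum_i inner (dAx k i) (- dlam k i).
Proof.
have d0 : zero_sum R m l (fun i => y k.+1 i - (a i - c)).
  by rewrite /zero_sum/= sumrB a_zero_sum y_zero_sum subr0.
have gap : 0 <= \sum_i (inner (lam k.+1 i - mu i) (A i *m x k.+1 i - a i)
    - inner (P i *m (x k.+1 i - z i - (x k i - z i))) (x k.+1 i - z i)).
  have := addr_ge0 (primal_gap k) (dual_gap k).
  rewrite (_ : _ + _ = \sum_i (- inner (lam k.+1 i) (a i - A i *m x k.+1 i)
    + inner (P i *m dx k i) (z i - x k.+1 i)
    - inner (mu i) (A i *m x k.+1 i - a i))).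
    congr (_ <= _); apply: eq_bigr => i _.
    have -> : x k.+1 i - z i - (x k i - z i) = dx k i.
      by rewrite opprB addrA subrK.
    by rewrite !innerE; ring.
  by rewrite sumrB big_split/= sumrN; ring.
(* Orthogonality to the direction [y k.+1 i - (a i - c)], with [y k.+1] eliminated by the multiplier
   update. *)
have orth : \sum_i inner (lam k.+1 i - mu i
    + beta *: (A i *m x k.+1 i - a i - (A i *m x k i - a i)))
    (A i *m x k.+1 i - a i - beta^-1 *: (lam k i - mu i - (lam k.+1 i - mu i)))
    = 0.
  transitivity (\sum_i inner (lam k.+1 i + beta *: dAx k i)
      (y k.+1 i - (a i - c)) - \sum_i inner (mu i) (y k.+1 i - (a i - c))).
    rewrite -sumrB; apply: eq_bigr => i _; rewrite -innerNl -innerDl.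
    have hy : y k.+1 i = A i *m x k.+1 i - c + beta^-1 *: dlam k i.
      by rewrite -[beta^-1 *: _]opprK -(scaleNr beta^-1) -residualE opprB addrC subrK.
    congr inner.
      by rewrite opprB addrA subrK addrAC.
    move: hy; rewrite /dlam; move: (A i *m _) => p1 ->.
    by apply/matrixP => s t; rewrite !mxE; ring.
  by rewrite (multiplier_orthogonal _ d0) mu_orthogonal// subr0.
move: gap orth; set S := (X in 0 <= X); set O := (X in X = 0) => gap orth.
have SO : 0 <= 2 * S - 2 * O by rewrite orth mulr0 subr0 mulr_ge0.
rewrite -subr_ge0; move: SO; congr (_ <= _); rewrite /S /O !mulr_sumr /lyapunov /energy.
rewrite -!sumrB -big_split/= -sumrB; apply: eq_bigr => i _.
rewrite lyapunov_block ?metric_sym ?gt_eqF//.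
have -> : x k.+1 i - z i - (x k i - z i) = dx k i.
  by rewrite opprB addrA subrK.
have -> : lam k.+1 i - mu i - (lam k i - mu i) = dlam k i.
  by rewrite opprB addrA subrK.
have -> : A i *m x k.+1 i - a i - (A i *m x k i - a i) = dAx k i.
  by rewrite opprB addrA subrK.
have -> : lam k i - mu i - (lam k.+1 i - mu i) = - dlam k i.
  by rewrite !opprB addrA subrK.
by ring.
Qed.

(** The added term absorbs the cross term by telescoping. The shift is due to that estimate
    comparing two consecutive x-steps, hence starting at the second one. *)
Definition merit k : R := lyapunov k.+1 + step_norm k.

Lemma merit_decrease k : merit k.+1 <= merit k - energy k.+1.
Proof.
by have := lyapunov_step k.+1; have := cross_term_le k; rewrite /merit; lra.
Qed.

End Reference.

Lemma lyapunov_terms a z mu k i :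
  [/\ beta^-1 * inner (lam k i - mu i) (lam k i - mu i) <= lyapunov a z mu k,
      beta * inner (A i *m x k i - a i) (A i *m x k i - a i)
        <= lyapunov a z mu k
    & inner (P i *m (x k i - z i)) (x k i - z i) <= lyapunov a z mu k].
Proof.
pose g j := beta^-1 * inner (lam k j - mu j) (lam k j - mu j)
  + beta * inner (A j *m x k j - a j) (A j *m x k j - a j)
  + inner (P j *m (x k j - z j)) (x k j - z j).
have h1 j : 0 <= beta^-1 * inner (lam k j - mu j) (lam k j - mu j).
  by rewrite mulr_ge0 ?inner_ge0// invr_ge0 ltW.
have h2 j : 0 <= beta * inner (A j *m x k j - a j) (A j *m x k j - a j).
  by rewrite mulr_ge0 ?inner_ge0// ltW.
have h3 j := metric_ge0 (x k j - z j).
have : g i <= lyapunov a z mu k.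
  by apply: ler_sum_term => j; rewrite !addr_ge0.
have := (h1 i, h2 i, h3 i).
by rewrite /g => -[[? ?] ?] ?; split; lra.
Qed.

Lemma lyapunov_ge0 a z mu k : 0 <= lyapunov a z mu k.
Proof.
apply: sumr_ge0 => i _; rewrite !addr_ge0// ?metric_ge0//.
  by rewrite mulr_ge0 ?inner_ge0// invr_ge0 ltW.
by rewrite mulr_ge0 ?inner_ge0// ltW.
Qed.

Lemma energy_terms k i :
  [/\ beta^-1 * inner (dlam k i) (dlam k i) <= energy k,
      beta * inner (dAx k i) (dAx k i) <= energy k
    & inner (P i *m dx k i) (dx k i) <= energy k].
Proof.
pose g j := beta^-1 * inner (dlam k j) (dlam k j)
  + beta * inner (dAx k j) (dAx k j) + inner (P j *m dx k j) (dx k j).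
have h1 j : 0 <= beta^-1 * inner (dlam k j) (dlam k j).
  by rewrite mulr_ge0 ?inner_ge0// invr_ge0 ltW.
have h2 j : 0 <= beta * inner (dAx k j) (dAx k j).
  by rewrite mulr_ge0 ?inner_ge0// ltW.
have h3 j := metric_ge0 (dx k j).
have : g i <= energy k by apply: ler_sum_term => j; rewrite !addr_ge0.
have := (h1 i, h2 i, h3 i).
by rewrite /g => -[[? ?] ?] ?; split; lra.
Qed.

Lemma energy_ge0 k : 0 <= energy k.
Proof.
apply: sumr_ge0 => i _; rewrite !addr_ge0// ?metric_ge0//.
  by rewrite mulr_ge0 ?inner_ge0// invr_ge0 ltW.
by rewrite mulr_ge0 ?inner_ge0// ltW.
Qed.

Lemma step_norm_ge0 k : 0 <= step_norm k.
Proof. by apply: sumr_ge0 => i _; exact: metric_ge0. Qed.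

(** * Consequences of the monotone decrease of the merit function *)

Section Descent.
Variables (a : 'I_m -> 'cV[R]_l) (z : blocks R n) (mu : 'I_m -> 'cV[R]_l).
Hypothesis decrease : forall k, merit a z mu k.+1 <= merit a z mu k - energy k.+1.

Lemma merit_nonincreasing k k' :
  (k <= k')%N -> merit a z mu k' <= merit a z mu k.
Proof.
move=> kk'; rewrite -(subnKC kk'); elim: (k' - k)%N => [|j IH].
  by rewrite addn0.
rewrite addnS; apply: le_trans IH; apply: le_trans (decrease _) _.
by rewrite gerBl energy_ge0.
Qed.

Lemma lyapunov_le_merit k : lyapunov a z mu k.+1 <= merit a z mu k.
Proof. by rewrite lerDl step_norm_ge0. Qed.

Lemma merit_ge0 k : 0 <= merit a z mu k.
Proof. by rewrite addr_ge0 ?lyapunov_ge0 ?step_norm_ge0. Qed.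

Lemma lyapunov_bounded k : lyapunov a z mu k.+1 <= merit a z mu 0.
Proof.
exact: le_trans (lyapunov_le_merit _) (merit_nonincreasing (leq0n _)).
Qed.

(** The energy is squeezed between 0 and the consecutive differences of a convergent sequence. *)
Lemma energy_cvg0 : energy k.+1 @[k --> \oo] --> 0.
Proof.
have cv : cvgn (merit a z mu).
  apply: nonincreasing_is_cvgn.
    by move=> k k'; exact: merit_nonincreasing.
  by exists 0 => _ [k _ <-]; exact: merit_ge0.
have cvS : merit a z mu k.+1 @[k --> \oo] --> limn (merit a z mu).
  by move: cv; rewrite -(cvg_shiftS (merit a z mu)).
apply: (@squeeze_cvg0 _ _ _ _ _ (fun k => merit a z mu k - merit a z mu k.+1)).
  by move=> k; rewrite energy_ge0/=; have := decrease k; lra.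
by rewrite -(subrr (limn (merit a z mu))); apply: cvgB.
Qed.

(** A nonnegative nonincreasing sequence stays below any value it takes once, so a single small
    value found through [U] suffices. *)
Lemma merit_cvg0 (U : set_system nat) (s : nat -> nat) : ProperFilter U ->
  merit a z mu (s k) @[k --> U] --> 0 -> merit a z mu k @[k --> \oo] --> 0.
Proof.
move=> UF U0; apply/cvgrPdist_lt => e e0.
have /filter_ex[N /=] : \forall k \near U, `|0 - merit a z mu (s k)| < e.
  by move/cvgrPdist_lt : U0; apply.
rewrite sub0r normrN ger0_norm ?merit_ge0// => Ne.
exists (s N) => // k /= Nk; rewrite sub0r normrN ger0_norm ?merit_ge0//.
by apply: le_lt_trans Ne; exact: merit_nonincreasing.
Qed.

End Descent.

(** * Bounds and limits obtained from the saddle point as reference *)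

Section SaddlePoint.
Variables (xs : blocks R n) (ls : 'cV[R]_l).
Hypothesis hm : (0 < m)%N.
Hypothesis hsaddle : saddle_point f X A b xs ls.

Let as_ i : 'cV[R]_l := A i *m xs i.
Let v : R := total_obj f xs.

Lemma saddle_feasible : \sum_i A i *m xs i = b.
Proof.
have [_ hl _] := hsaddle.
set r := \sum_i A i *m xs i - b.
suff : r = 0 by move=> /eqP; rewrite subr_eq0 => /eqP.
apply: inner_eq0; apply/eqP; rewrite eq_le inner_ge0 andbT.
(* The Lagrangian is affine in the multiplier with slope [- r]; moving from [ls] to [ls - r] would
   raise it by the squared length of [r]. *)
by have := hl (ls - r); rewrite /lagrangian -/r !innerE; lra.
Qed.

Lemma shift_sum : \sum_(i < m) c = b.
Proof.
rewrite sumr_const card_ord -scaler_nat scalerA mulfV ?scale1r//.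
by rewrite pnatr_eq0 -lt0n.
Qed.

Lemma saddle_zero_sum : zero_sum R m l (fun i => as_ i - c).
Proof. by rewrite /zero_sum/= sumrB saddle_feasible shift_sum subrr. Qed.

Lemma constant_orthogonal d : zero_sum R m l d ->
  \sum_i inner ls (d i) = 0.
Proof. by move=> d0; rewrite -inner_sumr d0 inner0r. Qed.

Lemma saddle_dual_gap u : prod_set X u ->
  0 <= total_obj f u - v - \sum_i inner ls (A i *m u i - as_ i).
Proof.
move=> Xu; have [_ _ /(_ _ Xu)] := hsaddle.
rewrite /lagrangian saddle_feasible subrr inner0r subr0 -/v.
by rewrite -inner_sumr sumrB saddle_feasible; lra.
Qed.

Lemma saddle_decrease k : merit as_ xs (fun=> ls) k.+1 <=
  merit as_ xs (fun=> ls) k - energy k.+1.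
Proof.
apply: (@merit_decrease as_ xs (fun=> ls) v) => [j|j||d].
- by apply: total_first_order; have [] := hsaddle.
- by apply: saddle_dual_gap => i; exact: x_in.
- exact: saddle_zero_sum.
- exact: constant_orthogonal.
Qed.

Let C := merit as_ xs (fun=> ls) 0.

Lemma Ax_bounded k i :
  inner (A i *m x k.+1 i - as_ i) (A i *m x k.+1 i - as_ i) <= beta^-1 * C.
Proof.
have [_ + _] := lyapunov_terms as_ xs (fun=> ls) k.+1 i.
have := lyapunov_bounded saddle_decrease k.
by move=> /[swap] /le_trans /[apply]; rewrite ler_pdivlMl.
Qed.

Lemma lam_bounded k i :
  inner (lam k.+1 i) (lam k.+1 i) <= 2 * (beta * C) + 2 * inner ls ls.
Proof.
have [+ _ _] := lyapunov_terms as_ xs (fun=> ls) k.+1 i.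
have := lyapunov_bounded saddle_decrease k.
move=> /[swap] /le_trans /[apply]; rewrite ler_pdivrMl// => h.
rewrite -[lam k.+1 i](subrK ls); apply: le_trans (sqr_innerD_le _ _) _.
by rewrite lerD2r ler_pM2l.
Qed.

Lemma x_bounded k i :
  inner (P i *m (x k.+1 i - xs i)) (x k.+1 i - xs i) <= C.
Proof.
have [_ _ /le_trans] := lyapunov_terms as_ xs (fun=> ls) k.+1 i.
by apply; exact: lyapunov_bounded saddle_decrease k.
Qed.

Lemma increments_cvg0 i :
  [/\ dlam k.+1 i @[k --> \oo] --> (0 : 'cV[R]_l),
      dAx k.+1 i @[k --> \oo] --> (0 : 'cV[R]_l)
    & inner (P i *m dx k.+1 i) (dx k.+1 i) @[k --> \oo] --> 0].
Proof.
have e0 := energy_cvg0 saddle_decrease.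
split.
- apply: inner_cvg0; apply: (@squeeze_cvg0 _ _ _ _ _ (fun k => beta * energy k.+1)).
    move=> k; rewrite inner_ge0/=.
    by have [+ _ _] := energy_terms k.+1 i; rewrite ler_pdivrMl.
  by rewrite -(mulr0 beta); apply: cvgMr.
- apply: inner_cvg0; apply: (@squeeze_cvg0 _ _ _ _ _ (fun k => beta^-1 * energy k.+1)).
    move=> k; rewrite inner_ge0/=.
    by have [_ + _] := energy_terms k.+1 i; rewrite ler_pdivlMl.
  by rewrite -(mulr0 beta^-1); apply: cvgMr.
- apply: squeeze_cvg0 e0 => k; rewrite metric_ge0/=.
  by have [] := energy_terms k.+1 i.
Qed.

Definition residual k i : 'cV[R]_l := A i *m x k i - c - y k i.

(** The multiplier update makes the residual proportional to the multiplier increment. *)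
Lemma residual_cvg0 i : residual k.+2 i @[k --> \oo] --> (0 : 'cV[R]_l).
Proof.
under eq_fun do rewrite /residual residualE.
have [h _ _] := increments_cvg0 i.
by rewrite -(scaler0 _ (- beta^-1)); exact: cvgZr.
Qed.

Lemma step_cvg0 i : inner (P i *m dx k.+1 i) (x k.+2 i - xs i) @[k --> \oo] --> 0.
Proof.
have [_ _ h] := increments_cvg0 i.
apply: (psd_cvg0 (metric_sym i) (@metric_ge0 i) h (C := C)) => k.
exact: x_bounded.
Qed.

(** The saddle inequality bounds the objective gap below by [lo], and the x-steps tested at [xs]
    bound it above by [up]. In both, orthogonality to the zero-sum family [y k.+2 i - (as_ i - c)]
    trades the multiplier terms for residuals and increments, all vanishing. *)
Lemma objective_cvg : total_obj f (x k.+2) @[k --> \oo] --> v.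
Proof.
have hx k : prod_set X (x k.+1) by move=> i; exact: x_in.
pose lo k := \sum_i inner ls (residual k.+2 i).
pose up k := \sum_i (inner (lam k.+2 i) (residual k.+2 i)
  + beta * inner (dAx k.+1 i) (residual k.+2 i)
  - beta * inner (dAx k.+1 i) (A i *m x k.+2 i - as_ i)
  - inner (P i *m dx k.+1 i) (x k.+2 i - xs i)).
have d0 k : zero_sum R m l (fun i => y k.+1 i - (as_ i - c)).
  by rewrite /zero_sum/= sumrB saddle_zero_sum y_zero_sum subr0.
have yE k i : y k i - (as_ i - c) = A i *m x k i - as_ i - residual k i.
  by rewrite /residual; apply/matrixP => s t; rewrite !mxE; ring.
have lo_le k : lo k <= total_obj f (x k.+2) - v.
  have := saddle_dual_gap (hx k.+1); have := constant_orthogonal (d0 k.+1).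
  under eq_bigr do rewrite yE innerDr innerNr.
  by rewrite sumrB /lo; lra.
have up_ge k : total_obj f (x k.+2) - v <= up k.
  have [Xxs _ _] := hsaddle.
  have := total_first_order k.+1 Xxs; have := multiplier_orthogonal k.+1 (d0 k.+1).
  rewrite -/v => orth gap.
  suff <- : - \sum_i inner (lam k.+2 i) (as_ i - A i *m x k.+2 i)
      + \sum_i inner (P i *m dx k.+1 i) (xs i - x k.+2 i) = up k.
    by rewrite /as_; lra.
  rewrite [LHS]addrC -[LHS]subr0 -[X in _ - X = _]orth -!sumrB; apply: eq_bigr => i _ /=.
  by rewrite yE !innerE; ring.
have h0 i := residual_cvg0 i.
have lo0 : lo k @[k --> \oo] --> 0.
  apply: cvg_sumr0 => i; rewrite -(inner0r ls).
  by apply: cvg_inner; [exact: cvg_cst|exact: h0].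
have up0 : up k @[k --> \oo] --> 0.
  apply: cvg_sumr0 => i; have [_ hA _] := increments_cvg0 i.
  have h1 : inner (lam k.+2 i) (residual k.+2 i) @[k --> \oo] --> 0.
    under eq_fun do rewrite innerC.
    by apply: (inner_bounded_cvg0 (h0 i)) => k; exact: lam_bounded.
  have h2 : inner (dAx k.+1 i) (residual k.+2 i) @[k --> \oo] --> 0.
    by rewrite -(inner0l (0 : 'cV[R]_l)); apply: cvg_inner.
  have h3 : inner (dAx k.+1 i) (A i *m x k.+2 i - as_ i) @[k --> \oo] --> 0.
    by apply: (inner_bounded_cvg0 hA) => k; exact: Ax_bounded.
  have := cvgB (cvgB (cvgD h1 (cvgM (cvg_cst beta) h2)) (cvgM (cvg_cst beta) h3)) (step_cvg0 i).
  by rewrite !mulr0 addr0 !subr0; exact.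
apply: cvg_zero.
apply: (@squeeze_cvgr _ _ _ _ lo up) lo0 up0; apply: nearW => k.
by rewrite lo_le up_ge.
Qed.

(** * Optimal value and dual optimality for the split problem *)

Lemma split_feasible_ge u : split_feasible X A b u -> v <= total_obj f u.1.
Proof.
move=> [Xu u0 hu]; have := saddle_dual_gap Xu.
have -> : \sum_i inner ls (A i *m u.1 i - as_ i) =
    \sum_i inner ls (u.2 i) - \sum_i inner ls (as_ i - c).
  rewrite -sumrB; apply: eq_bigr => i _; rewrite -hu -/c !innerE.
  by ring.
by rewrite !constant_orthogonal//; [lra|exact: saddle_zero_sum].
Qed.

Lemma split_valueE : split_value f X A b = v%:E.
Proof.
apply/eqP; rewrite eq_le; apply/andP; split.
  apply: ereal_inf_lbound; exists (xs, fun i => as_ i - c) => //.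
  by split => //; [case: hsaddle|exact: saddle_zero_sum].
by apply: le_ereal_inf_tmp => _ [u hu <-]; rewrite lee_fin split_feasible_ge.
Qed.

(** Every dual value is at most [v], as the pair [(xs, as_ - c)] has zero constraint residual; the
    gap condition shows that the dual value at [mu] is at least [v]. *)
Lemma split_dual_optimal_of_gap (a mu : 'I_m -> 'cV[R]_l) :
  zero_sum R m l (fun i => a i - c) ->
  (forall d, zero_sum R m l d -> \sum_i inner (mu i) (d i) = 0) ->
  (forall u, prod_set X u ->
    0 <= total_obj f u - v - \sum_i inner (mu i) (A i *m u i - a i)) ->
  split_dual_optimal f X A b mu.
Proof.
move=> a0 mu0 gap nu; apply: (@le_trans _ _ v%:E).
  apply: ereal_inf_lbound; exists (xs, fun i => as_ i - c).
    by split; [case: hsaddle|exact: saddle_zero_sum].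
  congr EFin; rewrite /split_lagrangian/= big1 ?subr0// => i _.
  by rewrite -/c subrr inner0r.
apply: le_ereal_inf_tmp => _ [u [Xu u0] <-]; rewrite lee_fin.
have := gap _ Xu; have := mu0 _ a0; have := mu0 _ u0.
rewrite /split_lagrangian -/c => h1 h2 h3.
have -> : \sum_i inner (mu i) (A i *m u.1 i - c - u.2 i) =
    \sum_i inner (mu i) (A i *m u.1 i - a i)
    + \sum_i inner (mu i) (a i - c) - \sum_i inner (mu i) (u.2 i).
  rewrite -big_split -sumrB; apply: eq_bigr => i _ /=.
  by rewrite !innerE; ring.
by move: h3; rewrite h1 h2; lra.
Qed.

(* The limits along an ultrafilter finer than [\oo], which exist by boundedness,
   form a reference point for which the merit function tends to 0 along the
   ultrafilter, hence, being monotone, along [\oo]. *)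
Lemma iterates_cvg : exists (a : 'I_m -> 'cV[R]_l) (z : blocks R n)
    (mu : 'I_m -> 'cV[R]_l),
  [/\ zero_sum R m l (fun i => a i - c), split_dual_optimal f X A b mu,
      forall i, lam k.+2 i @[k --> \oo] --> mu i,
      forall i, A i *m x k.+2 i @[k --> \oo] --> a i
    & forall i, ~~ exact i -> x k.+2 i @[k --> \oo] --> z i].
Proof.
have [U [UU sU]] := @ultraFilterLemma nat \oo _.
have UF : ProperFilter U by exact: ultra_proper.
have toU (V : topologicalType) (g : nat -> V) (p : V) :
    g k @[k --> \oo] --> p -> g k @[k --> U] --> p.
  by move=> h B /h; exact: sU.
have hmu' i : exists p : 'cV[R]_l, lam k.+2 i @[k --> U] --> p.
  by apply: (ultra_bounded_cvg UU); apply: nearW => k; exact: lam_bounded.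
have [mu hmu] := choice hmu'.
have ha' i : exists p : 'cV[R]_l, A i *m x k.+2 i @[k --> U] --> p.
  apply: (ultra_bounded_cvg
    (C := 2 * (beta^-1 * C) + 2 * inner (as_ i) (as_ i)) UU).
  apply: nearW => k; rewrite -[A i *m _](subrK (as_ i)).
  apply: le_trans (sqr_innerD_le _ _) _.
  by rewrite lerD2r ler_pM2l//; exact: Ax_bounded.
have [a ha] := choice ha'.
have hz' i : exists z : 'cV[R]_(n i),
    ~~ exact i -> x k.+2 i @[k --> U] --> z.
  (* In an exact block the value 0 is arbitrary: it only enters multiplied by [P i = 0]. *)
  case: (boolP (exact i)) => ei; first by exists 0.
  pose g := tau i - beta * spectral_radius ((A i)^T *m A i).
  have g0 : 0 < g by rewrite subr_gt0 htau.
  have [w hw] : exists w : 'cV[R]_(n i), x k.+2 i - xs i @[k --> U] --> w.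
    apply: (ultra_bounded_cvg (C := g^-1 * C) UU); apply: nearW => k.
    rewrite ler_pdivlMl//; apply: le_trans (x_bounded k.+1 i).
    by rewrite /metric (negbTE ei); apply: prox_form_ge; exact: ltW.
  exists (w + xs i) => _.
  have -> : (fun k => x k.+2 i) = (fun k => x k.+2 i - xs i + xs i).
    by apply: funext => k; rewrite subrK.
  by apply: cvgD hw _; exact: cvg_cst.
pose z i := sval (cid (hz' i)).
have hz i : ~~ exact i -> x k.+2 i @[k --> U] --> z i := svalP (cid (hz' i)).
(* Since [y] sums to zero, the sum of the residuals has the two limits 0 and [\sum_i (a i - c)]. *)
have a0 : zero_sum R m l (fun i => a i - c).
  have h1 : \sum_i residual k.+2 i @[k --> U] --> (0 : 'cV[R]_l).
    by apply: cvg_sumr0 => i; apply: toU; exact: residual_cvg0.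
  have h2 : \sum_i residual k.+2 i @[k --> U] --> \sum_i (a i - c).
    have -> : (fun k => \sum_i residual k.+2 i) =
        (fun k => \sum_i (A i *m x k.+2 i - c)).
      by apply: funext => k; rewrite /residual sumrB y_zero_sum subr0.
    by apply: cvg_sumr => i; apply: cvgB => //; exact: cvg_cst.
  exact: (cvg_unique _ h2 h1).
have mu0 d : zero_sum R m l d -> \sum_i inner (mu i) (d i) = 0.
  move=> d0.
  have : \sum_i inner (lam k.+2 i + beta *: dAx k.+1 i) (d i) @[k --> U]
      --> \sum_i inner (mu i + beta *: 0) (d i).
    apply: cvg_sumr => i; apply: cvg_inner; last exact: cvg_cst.
    apply: cvgD => //; apply: cvgZr; apply: toU.
    by have [] := increments_cvg0 i.
  under eq_fun do rewrite multiplier_orthogonal//.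
  under eq_bigr do rewrite scaler0 addr0.
  by move=> h; exact: (cvg_unique _ h (cvg_cst 0)).
have fU := toU _ _ _ objective_cvg.
have gap u : prod_set X u ->
    0 <= total_obj f u - v - \sum_i inner (mu i) (A i *m u i - a i).
  move=> Xu.
  have hP : \sum_i inner (P i *m dx k.+1 i) (u i - x k.+2 i) @[k --> U] --> 0.
    apply: toU; apply: cvg_sumr0 => i; have [_ _ h] := increments_cvg0 i.
    have h1 : inner (P i *m dx k.+1 i) (u i - xs i) @[k --> \oo] --> 0.
      by apply: (psd_cvg0 (metric_sym i) (@metric_ge0 i) h) => _; exact: lexx.
    have -> : (fun k => inner (P i *m dx k.+1 i) (u i - x k.+2 i)) =
        (fun k => inner (P i *m dx k.+1 i) (u i - xs i)
          - inner (P i *m dx k.+1 i) (x k.+2 i - xs i)).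
      by apply: funext => k; rewrite !innerE; ring.
    by rewrite -(subr0 0); apply: cvgB h1 (step_cvg0 i).
  have hL : \sum_i inner (lam k.+2 i) (A i *m u i - A i *m x k.+2 i) @[k --> U]
      --> \sum_i inner (mu i) (A i *m u i - a i).
    apply: cvg_sumr => i; apply: cvg_inner => //.
    by apply: cvgB => //; exact: cvg_cst.
  have lim : total_obj f u - total_obj f (x k.+2)
      - \sum_i inner (lam k.+2 i) (A i *m u i - A i *m x k.+2 i)
      + \sum_i inner (P i *m dx k.+1 i) (u i - x k.+2 i) @[k --> U]
      --> total_obj f u - v - \sum_i inner (mu i) (A i *m u i - a i) + 0.
    apply: cvgD hP; apply: cvgB hL; apply: cvgB fU; exact: cvg_cst.
  rewrite -[leRHS]addr0; apply: (cvgr_to_ge lim); apply: nearW => k.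
  exact: total_first_order.
(* The x-step [k] is tested at the iterate [x j.+2], which lies in the constraint set, and [j] then
   runs along [U]; the value at the reference point is thus the known limit [v] of the objective. *)
have pgap k : 0 <= v - total_obj f (x k.+1)
    - \sum_i inner (lam k.+1 i) (a i - A i *m x k.+1 i)
    + \sum_i inner (P i *m dx k i) (z i - x k.+1 i).
  have hL : \sum_i inner (lam k.+1 i) (A i *m x j.+2 i - A i *m x k.+1 i)
      @[j --> U] --> \sum_i inner (lam k.+1 i) (a i - A i *m x k.+1 i).
    apply: cvg_sumr => i; apply: cvg_inner; first exact: cvg_cst.
    by apply: cvgB => //; exact: cvg_cst.
  have hP : \sum_i inner (P i *m dx k i) (x j.+2 i - x k.+1 i)
      @[j --> U] --> \sum_i inner (P i *m dx k i) (z i - x k.+1 i).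
    apply: cvg_sumr => i; case: (boolP (exact i)) => ei.
      under eq_fun do rewrite /metric ei mul0mx inner0l.
      by rewrite /metric ei mul0mx inner0l; exact: cvg_cst.
    apply: cvg_inner; first exact: cvg_cst.
    by apply: cvgB; [exact: hz|exact: cvg_cst].
  have lim : total_obj f (x j.+2) - total_obj f (x k.+1)
      - \sum_i inner (lam k.+1 i) (A i *m x j.+2 i - A i *m x k.+1 i)
      + \sum_i inner (P i *m dx k i) (x j.+2 i - x k.+1 i) @[j --> U]
      --> v - total_obj f (x k.+1)
      - \sum_i inner (lam k.+1 i) (a i - A i *m x k.+1 i)
      + \sum_i inner (P i *m dx k i) (z i - x k.+1 i).
    by apply: cvgD hP; apply: cvgB hL; apply: cvgB fU _; exact: cvg_cst.
  apply: (cvgr_to_ge lim); apply: nearW => j.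
  by apply: total_first_order => i; exact: x_in.
have dgap k : 0 <= total_obj f (x k.+1) - v
    - \sum_i inner (mu i) (A i *m x k.+1 i - a i).
  by apply: gap => i; exact: x_in.
have dec := merit_decrease pgap dgap a0 mu0.
have self0 p (Q : 'M[R]_p) (u : nat -> 'cV[R]_p) (w : 'cV[R]_p) :
    u k @[k --> U] --> w -> inner (Q *m (u k - w)) (u k - w) @[k --> U] --> 0.
  move=> uw; have uw0 : u k - w @[k --> U] --> (0 : 'cV[R]_p).
    by rewrite -(subrr w); apply: cvgB => //; exact: cvg_cst.
  rewrite -(inner0r (Q *m 0)); apply: cvg_inner => //.
  exact: cvg_mulmxr.
have lyapU : lyapunov a z mu k.+2 @[k --> U] --> 0.
  apply: cvg_sumr0 => i.
  have h1 : inner (lam k.+2 i - mu i) (lam k.+2 i - mu i) @[k --> U] --> 0.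
    by under eq_fun do rewrite -[X in inner X]mul1mx; exact: self0.
  have h2 : inner (A i *m x k.+2 i - a i) (A i *m x k.+2 i - a i)
      @[k --> U] --> 0.
    by under eq_fun do rewrite -[X in inner X]mul1mx;
      exact: (self0 _ _ (fun k => A i *m x k.+2 i)).
  have h3 : inner (P i *m (x k.+2 i - z i)) (x k.+2 i - z i) @[k --> U] --> 0.
    case: (boolP (exact i)) => ei; last by apply: self0; exact: hz.
    by under eq_fun do rewrite /metric ei mul0mx inner0l; exact: cvg_cst.
  have -> : 0 = beta^-1 * 0 + beta * 0 + 0 :> R by rewrite !mulr0 !addr0.
  apply: cvgD h3; apply: cvgD; apply: cvgM => //; exact: cvg_cst.
have merit0 : merit a z mu k @[k --> \oo] --> 0.
  (* Reindexing by the successor matches [lyapunov] at [k.+2], whose limit along [U] is known. *)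
  apply: (@merit_cvg0 _ _ _ dec U succn).
  rewrite -(addr0 0); apply: cvgD => //; apply: toU.
  by apply: cvg_sumr0 => i; have [] := increments_cvg0 i.
have lyap0 : lyapunov a z mu k.+2 @[k --> \oo] --> 0.
  have : merit a z mu k.+1 @[k --> \oo] --> 0.
    by rewrite (cvg_shiftS (merit a z mu)).
  by apply: squeeze_cvg0 => k; rewrite lyapunov_ge0 lyapunov_le_merit.
have scaled0 t : t * lyapunov a z mu k.+2 @[k --> \oo] --> 0.
  by rewrite -(mulr0 t); apply: cvgM => //; exact: cvg_cst.
exists a, z, mu; split => //.
- exact: split_dual_optimal_of_gap a0 mu0 gap.
- move=> i; apply: cvg_zero; apply: inner_cvg0.
  apply: squeeze_cvg0 (scaled0 beta) => k; rewrite inner_ge0/=.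
  by have [+ _ _] := lyapunov_terms a z mu k.+2 i; rewrite ler_pdivrMl.
- move=> i; apply: cvg_zero; apply: inner_cvg0.
  apply: squeeze_cvg0 (scaled0 beta^-1) => k; rewrite inner_ge0/=.
  by have [_ + _] := lyapunov_terms a z mu k.+2 i; rewrite ler_pdivlMl.
- move=> i ei; apply: cvg_zero; apply: inner_cvg0.
  pose g := tau i - beta * spectral_radius ((A i)^T *m A i).
  have g0 : 0 < g by rewrite subr_gt0 htau.
  apply: squeeze_cvg0 (scaled0 g^-1) => k; rewrite inner_ge0/= ler_pdivlMl//.
  have [_ _] := lyapunov_terms a z mu k.+2 i; apply: le_trans.
  by rewrite /metric (negbTE ei); apply: prox_form_ge; exact: ltW.
Qed.

End SaddlePoint.

End Algorithm.

(** * From shifted to full sequences, lower semicontinuity, and conclusion *)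

Lemma cvg_shift2 (V : topologicalType) (g : nat -> V) (p : V) :
  g k.+2 @[k --> \oo] --> p -> g k @[k --> \oo] --> p.
Proof.
move=> h B /h [N _ NB]; exists N.+2 => // -[|[|k]]//= kN.
exact: NB.
Qed.

(** The point [(z, g z - e)] lies outside the closed epigraph, hence so do all nearby points at the
    same height. *)
Lemma closed_function_lsc (R : realType) (p : nat) (g : 'cV[R]_p -> R)
    (T : Type) (F : set_system T) (u : T -> 'cV[R]_p) (z : 'cV[R]_p) (e : R) :
  Filter F -> closed_function g -> u k @[k --> F] --> z -> 0 < e ->
  \forall k \near F, g z - e <= g (u k).
Proof.
move=> FF gc uz e0.
have zN : (~` [set w : 'cV[R]_p * R | g w.1 <= w.2]) (z, g z - e).
  by move=> /=; apply/negP; rewrite -ltNge ltrBlDr ltrDl.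
have uz2 : (u k, g z - e) @[k --> F] --> (z, g z - e).
  exact: (@cvg_pair _ _ _ _ _ _ _ _ _ u (fun=> g z - e) uz (cvg_cst _)).
have Fn : \forall k \near F, ~ (g (u k) <= g z - e) :=
  uz2 _ (open_nbhs_nbhs (conj (closed_openC gc) zN)).
by apply: filterS Fn => k /negP; rewrite -ltNge => /ltW.
Qed.

Lemma total_obj_le_lim (R : realType) (m : nat) (n : 'I_m -> nat)
    (f : forall i : 'I_m, 'cV[R]_(n i) -> R) (x : nat -> blocks R n)
    (z : blocks R n) (v : R) :
  (forall i, closed_function (@f i)) -> (forall i, x k i @[k --> \oo] --> z i) ->
  total_obj f (x k) @[k --> \oo] --> v -> total_obj f z <= v.
Proof.
move=> fc xz fv; apply/ler_addgt0Pr => e e0.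
(* Dividing by [m.+1] keeps the denominator nonzero for every [m], and [m] copies still add up to at
   most [e]. *)
pose e' := e / m.+1%:R.
have e'0 : 0 < e' by rewrite divr_gt0.
rewrite -lerBlDr; apply: (cvgr_to_ge fv).
have : \forall k \near \oo, forall i, f i (z i) - e' <= f i (x k i).
  by apply: filter_forall => i; exact: closed_function_lsc (fc i) (xz i) e'0.
apply: filterS => k hk.
apply: (@le_trans _ _ (\sum_i (f i (z i) - e'))); last exact: ler_sum.
rewrite sumrB lerB// sumr_const card_ord -[leLHS]mulr_natr /e' mulrAC.
by rewrite ler_pdivrMr// ler_pM2l// ler_nat.
Qed.

Theorem theorem2p1 (R : realType) (m l : nat) (n : 'I_m -> nat)
    (f : forall i : 'I_m, 'cV[R]_(n i) -> R)
    (X : forall i : 'I_m, set 'cV[R]_(n i))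
    (A : forall i : 'I_m, 'M[R]_(l, n i)) (b : 'cV[R]_l)
    (beta : R) (exact : 'I_m -> bool) (tau : 'I_m -> R)
    (x : nat -> blocks R n) (y lam : nat -> 'I_m -> 'cV[R]_l)
    (hm : (2 <= m)%N)
    (hf_convex : forall i : 'I_m, convex_function setT (f i))
    (hf_closed : forall i : 'I_m, closed_function (f i))
    (hX_convex : forall i : 'I_m, convex_set (X i))
    (hX_closed : forall i : 'I_m, closed (X i))
    (hsaddle : exists (xs : blocks R n) (ls : 'cV[R]_l),
       saddle_point f X A b xs ls)
    (hbeta : 0 < beta)
    (htau : forall i : 'I_m, ~~ exact i ->
       beta * spectral_radius ((A i)^T *m A i) < tau i)
    (hx0 : prod_set X (x 0%N)) (hy0 : zero_sum R m l (y 0%N))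
    (hgen : psadmm f X A b beta exact tau x y lam) :
  [/\ exists ls : 'I_m -> 'cV[R]_l,
        split_dual_optimal f X A b ls /\
        (forall i : 'I_m, lam k i @[k --> \oo] --> ls i),
      split_value f X A b \is a fin_num /\
        total_obj f (x k) @[k --> \oo] --> fine (split_value f X A b),
      forall i : 'I_m,
        (A i *m x k i - y k i - m%:R^-1 *: b) @[k --> \oo] --> (0 : 'cV[R]_l)
    & ((forall i : 'I_m, exact i) ->
         forall i : 'I_m,
           [/\ cvg (A i *m x k i @[k --> \oo]),
               cvg (y k i @[k --> \oo])
             & \rank (A i) = n i -> cvg (x k i @[k --> \oo])]) /\
      ((forall i : 'I_m, ~~ exact i) ->
         exists (xs : blocks R n) (ys : 'I_m -> 'cV[R]_l),
           [/\ split_optimal f X A b (xs, ys),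
               forall i : 'I_m, x k i @[k --> \oo] --> xs i
             & forall i : 'I_m, y k i @[k --> \oo] --> ys i])].
Proof.
have [xs [ls sad]] := hsaddle.
have m0 : (0 < m)%N by exact: leq_trans hm.
have [a [z [mu [a0 mu_opt hlam hAx hx]]]] :=
  iterates_cvg hf_convex hX_convex hbeta htau hgen m0 sad.
have res i : A i *m x k i - y k i - m%:R^-1 *: b @[k --> \oo] --> (0 : 'cV[R]_l).
  apply: cvg_shift2.
  have := residual_cvg0 hf_convex hX_convex hbeta htau hgen m0 sad i.
  by rewrite /residual; under eq_fun do rewrite addrAC.
have Ax_lim i : A i *m x k i @[k --> \oo] --> a i.
  exact: (@cvg_shift2 _ (fun k => A i *m x k i)).
have y_lim i : y k i @[k --> \oo] --> a i - m%:R^-1 *: b.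
  have -> : (fun k => y k i) = (fun k => A i *m x k i - m%:R^-1 *: b
      - (A i *m x k i - y k i - m%:R^-1 *: b)).
    apply: funext => k; move: (A i *m x k i) (m%:R^-1 *: b) => p c.
    by apply/matrixP => s t; rewrite !mxE; ring.
  rewrite -[a i - _]subr0; apply: cvgB => //.
  by apply: cvgB => //; exact: cvg_cst.
have val := split_valueE m0 sad.
have f_lim : total_obj f (x k) @[k --> \oo] --> total_obj f xs.
  have := @objective_cvg _ _ _ _ _ _ _ _ _ _ _ _ _ _
    hf_convex hX_convex hbeta htau hgen _ _ m0 sad.
  exact: (@cvg_shift2 _ (fun k => total_obj f (x k))).
split.
- exists mu; split => // i.
  exact: (@cvg_shift2 _ (fun k => lam k i)).
- by rewrite val.
- exact: res.
- split=> [_ i|prox].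
    split; [by apply/cvg_ex; exists (a i)|by apply/cvg_ex; eexists|].
    (* Full column rank gives the left inverse [B^T] of [A i], through which [x k i] is recovered
       from [A i *m x k i]. *)
    move=> rk; have /row_freeP[B AB] : row_free (A i)^T.
      by rewrite /row_free mxrank_tr rk.
    have BA : B^T *m A i = 1%:M.
      by rewrite -[A i]trmxK -trmx_mul AB trmx1.
    apply/cvg_ex; exists (B^T *m a i).
    have -> : (fun k => x k i) = (fun k => B^T *m (A i *m x k i)).
      by apply: funext => k; rewrite mulmxA BA mul1mx.
    exact: cvg_mulmxr.
  have x_lim i : x k i @[k --> \oo] --> z i.
    by apply: (@cvg_shift2 _ (fun k => x k i)); apply: hx.
  have aE i : A i *m z i = a i.
    have Az_lim : A i *m x k i @[k --> \oo] --> A i *m z i.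
      by apply: cvg_mulmxr; exact: x_lim.
    exact: (cvg_unique _ Az_lim (Ax_lim i)).
  exists z, (fun i => a i - m%:R^-1 *: b); split => //; split.
    split=> //= [i|i]; last by rewrite aE.
    apply: (closed_cvg _ (hX_closed i) _ _ (x_lim i)).
    apply: nearW => -[|k]; [exact: hx0|exact: x_in hgen k i].
  (* Lower semicontinuity puts the objective at [z] below its value at [xs], which bounds all
     feasible values from below. *)
  move=> u /(split_feasible_ge m0 sad); apply: le_trans.
  exact: total_obj_le_lim x_lim f_lim.
Qed.
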